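(* Let $w>0$, and let $A\in\mathbb{R}^{r\times m}$, $\Lambda=\mathrm{diag}(\lambda_1,\dots,\lambda_r)$ with $\lambda_1\ge\cdots\ge\lambda_r>0$, $\mathbf{b}\in\mathbb{R}^m$, $b_0\in\mathbb{R}$, and $\overline{A},\overline{\mathbf{b}},Q_0,\mathbf{q}_0$ be as defined in the context. Consider the problem, in the variable $\mathbf{z}=(\mathbf{x},y)$ with $\mathbf{x}\in\mathbb{R}^r$, $y\in\mathbb{R}$, $$\min_{\mathbf{z}\in\mathbb{R}^{r+1}}\ q(\mathbf{z})=\frac12\big\|\overline{A}^\top\mathbf{z}-\overline{\mathbf{b}}\big\|^2\quad\text{subject to}\quad c(\mathbf{z})=\frac12\mathbf{z}^\top Q_0\mathbf{z}-\mathbf{q}_0^\top\mathbf{z}=0 .$$ This problem has an optimal solution. Furthermore, $\mathbf{z}^*=(\mathbf{x}^*,y^* )$ is a global solution of it if and only if there exists a Lagrange multiplier $\lambda^*\in\mathbb{R}$ such that the following conditions hold: $$\Big(\Lambda+\frac{1}{2w}\lambda^*I_r\Big)\mathbf{x}^*=A\mathbf{b},\qquad y^*=b_0+\frac12\lambda^*,\qquad \lambda^*\ge-2w\lambda_r,\qquad y^*=\|\mathbf{x}^*\|^2 .$$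
   Context: Notation: $\|\cdot\|$ is the Euclidean norm, $\mathbf{1}_m$ the all-ones column vector of length $m$, $\mathbf{0}_n$ the zero column vector of length $n$, $I_n$ the $n\times n$ identity, $J_m:=I_m-\frac1m\mathbf{1}_m\mathbf{1}_m^\top$. Data: anchors $\mathbf{x}_1,\dots,\mathbf{x}_m\in\mathbb{R}^r$ and measurements $\boldsymbol{\delta}\in\mathbb{R}^m$. Let $D_{ij}=\|\mathbf{x}_i-\mathbf{x}_j\|^2$ and $B:=-\frac12J_mDJ_m$, which is positive semidefinite and is assumed (standing assumption) to have rank $r$. Let $B=U_r\Lambda U_r^\top$ be a spectral decomposition, where $\Lambda=\mathrm{diag}(\lambda_1,\dots,\lambda_r)$ with $\lambda_1\ge\cdots\ge\lambda_r>0$ the positive eigenvalues of $B$, and the columns of $U_r\in\mathbb{R}^{m\times r}$ are corresponding orthonormal eigenvectors. Let $A:=\Lambda^{1/2}U_r^\top=[\mathbf{a}_1,\dots,\mathbf{a}_m]\in\mathbb{R}^{r\times m}$. Set $\boldsymbol{\delta}_0:=\frac1mD\mathbf{1}_m$, $\ \mathbf{b}:=\frac12J_m(\boldsymbol{\delta}_0-\boldsymbol{\delta})\in\mathbb{R}^m$, $\ b_0:=\frac1m\mathbf{1}_m^\top\boldsymbol{\delta}-\frac{1}{2m^2}\mathbf{1}_m^\top D\mathbf{1}_m\in\mathbb{R}$. For a weight $w>0$ set $$\overline{A}:=\begin{bmatrix}\sqrt{2w}\,A&\mathbf{0}_r\\ \mathbf{0}_m^\top&1\end{bmatrix}\in\mathbb{R}^{(r+1)\times(m+1)},\quad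 \overline{\mathbf{b}}:=\begin{bmatrix}\sqrt{2w}\,\mathbf{b}\\ b_0\end{bmatrix},\quad Q_0:=\begin{bmatrix}I_r&\mathbf{0}_r\\ \mathbf{0}_r^\top&0\end{bmatrix},\quad \mathbf{q}_0:=\begin{bmatrix}\mathbf{0}_r\\ 1/2\end{bmatrix},\quad \mathbf{z}:=\begin{bmatrix}\mathbf{x}\\ y\end{bmatrix}.$$ The constraint $c(\mathbf{z})=0$ says $y=\|\mathbf{x}\|^2$, so the problem is a reformulation of $\min_{\mathbf{x}}\frac12(\|\mathbf{x}\|^2-b_0)^2+w\sum_{i=1}^m(\langle\mathbf{a}_i,\mathbf{x}\rangle-b_i)^2$. *)

(* Defs.v *)
From mathcomp Require Import all_boot all_order all_algebra.
From mathcomp Require Import reals.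

Set Implicit Arguments.
Unset Strict Implicit.
Unset Printing Implicit Defensive.

Import Order.TTheory GRing.Theory Num.Theory.
Local Open Scope ring_scope.

Section Definitions.
Variable R : realType.

(* Not the norm `|u|: on matrices that one is the sup norm. *)
Definition enorm n (u : 'cV[R]_n) : R := Num.sqrt (\sum_i u i 0 ^+ 2).

Definition dot n (u v : 'cV[R]_n) : R := (u^T *m v) 0 0.

Definition ones m : 'cV[R]_m := const_mx 1.

Definition centering m : 'M[R]_m := 1%:M - m%:R^-1 *: (ones m *m (ones m)^T).

Definition sqdist_mx m r (x : 'I_m -> 'cV[R]_r) : 'M[R]_m :=
  \matrix_(i, j) enorm (x i - x j) ^+ 2.

Definition gram_mx m (D : 'M[R]_m) : 'M[R]_m :=
  - 2^-1 *: (centering m *m D *m centering m).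

(* Only the r positive eigenvalues are kept: when r = \rank B, these r
   eigenpairs reconstruct B. *)
Definition reduced_spectral_decomposition m r
    (B : 'M[R]_m) (U : 'M[R]_(m, r)) (lam : 'rV[R]_r) : Prop :=
  [/\ forall i j : 'I_r, (i <= j)%N -> lam 0 j <= lam 0 i,
      forall i : 'I_r, 0 < lam 0 i,
      U^T *m U = 1%:M
    & B = U *m diag_mx lam *m U^T].

Definition coord_mx m r (U : 'M[R]_(m, r)) (lam : 'rV[R]_r) : 'M[R]_(r, m) :=
  diag_mx (map_mx Num.sqrt lam) *m U^T.

Definition rhs_vec m (D : 'M[R]_m) (delta : 'cV[R]_m) : 'cV[R]_m :=
  let delta0 := m%:R^-1 *: (D *m ones m) in
  2^-1 *: (centering m *m (delta0 - delta)).

Definition rhs_scal m (D : 'M[R]_m) (delta : 'cV[R]_m) : R :=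
  m%:R^-1 * dot (ones m) delta
    - (2 * m%:R ^+ 2)^-1 * dot (ones m) (D *m ones m).

Definition Abar m r (w : R) (A : 'M[R]_(r, m)) : 'M[R]_(r + 1, m + 1) :=
  block_mx (Num.sqrt (2 * w) *: A) 0 0 1%:M.

Definition bbar m (w : R) (b : 'cV[R]_m) (b0 : R) : 'cV[R]_(m + 1) :=
  col_mx (Num.sqrt (2 * w) *: b) (const_mx b0).

Definition Q0 r : 'M[R]_(r + 1) := block_mx 1%:M 0 0 0.

Definition q0 r : 'cV[R]_(r + 1) := col_mx 0 (const_mx 2^-1).

Definition zvec r (x : 'cV[R]_r) (y : R) : 'cV[R]_(r + 1) :=
  col_mx x (const_mx y).

Definition q_obj m r (w : R) (A : 'M[R]_(r, m)) (b : 'cV[R]_m) (b0 : R)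
    (z : 'cV[R]_(r + 1)) : R :=
  2^-1 * enorm ((Abar w A)^T *m z - bbar w b b0) ^+ 2.

Definition c_constr r (z : 'cV[R]_(r + 1)) : R :=
  2^-1 * dot z (Q0 r *m z) - dot (q0 r) z.

Definition global_solution (T : Type) (q c : T -> R) (z : T) : Prop :=
  c z = 0 /\ forall z', c z' = 0 -> q z <= q z'.

End Definitions.

Arguments ones {R} m.
Arguments centering {R} m.
Arguments Q0 {R} r.
Arguments q0 {R} r.

(* Main.v *)
(* Since A A^T = Lambda, eliminating y = |x|^2 turns the problem into the
   minimisation of f(x) = sum_i (w lam_i x_i^2 - 2 w (A b)_i x_i)
   + (|x|^2 - b0)^2 / 2, up to a constant. It is coercive, so a minimum exists.
   With nu = |x|^2 - b0 = mu / 2, f(z) - f(x) equals exactly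
   sum_i [(w lam_i + nu) (z_i - x_i)^2
          + 2 (z_i - x_i) ((w lam_i + nu) x_i - w (A b)_i)]
   + (|z|^2 - |x|^2)^2 / 2.
   Hence a stationary x with all w lam_i + nu >= 0 is a global minimiser.
   Conversely, moving one coordinate of a minimiser by t gives stationarity for
   small t, and then w lam_i + nu >= 0 by reflecting that coordinate
   (t = -2 x_i), which preserves |x|; if x_i = 0, a small t does it. *)
Require Import Defs.
From mathcomp Require Import all_boot all_order all_algebra ring lra.
From mathcomp Require Import boolp classical_sets reals topology normedtype derive.

Set Implicit Arguments.
Unset Strict Implicit.
Unset Printing Implicit Defensive.

Import Order.TTheory GRing.Theory Num.Theory.
Import numFieldNormedType.Exports.
Local Open Scope ring_scope.

(** * Sign conditions on a quartic in one variable *)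

(** The quartic is the change of the objective when a coordinate with value [x] moves by [t]; [g] is
    the stationarity residual and [k] the shifted curvature. *)
Lemma quartic_ge0 (R : realType) (k g x : R) :
  (forall t, 0 <= k * t ^+ 2 + 2 * t * g + 2^-1 * (2 * x * t + t ^+ 2) ^+ 2) ->
  g = 0 /\ 0 <= k.
Proof.
move=> H.
have g0 : g = 0.
  apply/eqP/negP => /negP gn0.
  (* For [|t| <= 1] all terms but [2 * t * g] are at most [C * t ^+ 2]. Taking [t = - g / d] keeps
     [|t| <= 1] and turns [2 * t * g] into [- 2 * d * t ^+ 2], which wins since [C < 2 * d]. *)
  pose C := `|k| + 4 * x ^+ 2 + 1.
  have C1 : 1 <= C by rewrite /C; have := normr_ge0 k; have := sqr_ge0 x; lra.
  pose d := C + `|g|; have g_ge0 := normr_ge0 g.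
  have d0 : 0 < d by rewrite /d; lra.
  pose t := - g / d.
  have tt : t ^+ 2 <= 1.
    rewrite -[leLHS]real_normK ?num_real// expr_le1 //.
    by rewrite /t normrM normrN normfV (gtr0_norm d0) ler_pdivrMr // mul1r /d; lra.
  have quart : 2^-1 * (2 * x * t + t ^+ 2) ^+ 2 <= (4 * x ^+ 2 + 1) * t ^+ 2.
    have -> : 2^-1 * (2 * x * t + t ^+ 2) ^+ 2 = 2^-1 * (2 * x + t) ^+ 2 * t ^+ 2.
      by ring.
    apply: ler_wpM2r; first exact: sqr_ge0.
    have := sqr_ge0 (2 * x - t); nra.
  have kt : k * t ^+ 2 <= `|k| * t ^+ 2.
    by apply: ler_wpM2r; [exact: sqr_ge0 | exact: ler_norm].
  have := H t; have gt : t * g = - d * t ^+ 2.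
    by rewrite /t; field; rewrite (gt_eqF d0).
  have t0 : 0 < t ^+ 2.
    by rewrite exprn_even_gt0 //= /t mulf_neq0 ?oppr_eq0 ?invr_eq0 ?(gt_eqF d0).
  suff : (C - 2 * d) * t ^+ 2 < 0.
    move: quart kt gt; rewrite /C; lra.
  by rewrite nmulr_rlt0 // /d; lra.
split=> //; rewrite leNgt; apply/negP => k0.
have [x0|xn0] := eqVneq x 0.
(* At [x = 0] this [t] gives the value [- k ^+ 2 / 2 < 0]. *)
- have := H (Num.sqrt (- k)).
  have -> : Num.sqrt (- k) ^+ 2 = - k by rewrite sqr_sqrtr // oppr_ge0 ltW.
  rewrite g0 x0; nra.
- have := H (- 2 * x); rewrite g0.
  have : 0 < x ^+ 2 by rewrite exprn_even_gt0.
  nra.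
Qed.

(** * Minimisers of a separable quadratic plus a quartic in the norm *)

Definition sqnorm (R : realType) n (x : 'cV[R]_n) : R := \sum_i x i 0 ^+ 2.

Section SeparableQuartic.
Variables (R : realType) (n : nat) (a p : 'I_n -> R) (c : R).
Implicit Types x z : 'cV[R]_n.

Definition sepquartic x : R :=
  \sum_i (a i * x i 0 ^+ 2 - 2 * p i * x i 0) + 2^-1 * (sqnorm x - c) ^+ 2.

Lemma sepquarticB z x : sepquartic z - sepquartic x =
  \sum_i ((a i + (sqnorm x - c)) * (z i 0 - x i 0) ^+ 2
          + 2 * (z i 0 - x i 0) * ((a i + (sqnorm x - c)) * x i 0 - p i))
  + 2^-1 * (sqnorm z - sqnorm x) ^+ 2.
Proof.
set nu := sqnorm x - c.
(* Writing [sqnorm z - c] as [nu] plus the increment of [sqnorm] splits the quartic part into a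
   linear and a square term; the linear one is then distributed over the coordinates. *)
transitivity (\sum_i (a i * z i 0 ^+ 2 - 2 * p i * z i 0)
   - \sum_i (a i * x i 0 ^+ 2 - 2 * p i * x i 0)
   + nu * (sqnorm z - sqnorm x) + 2^-1 * (sqnorm z - sqnorm x) ^+ 2).
  by rewrite /sepquartic /nu; field.
congr (_ + _); rewrite /sqnorm -!sumrB mulr_sumr -big_split /=.
by apply: eq_bigr => i _; ring.
Qed.

Lemma sepquartic_minP x :
  (forall z, sepquartic x <= sepquartic z) <->
  (forall i, (a i + (sqnorm x - c)) * x i 0 = p i /\
             0 <= a i + (sqnorm x - c)).
Proof.
split=> [xmin i|crit z]; last first.
  rewrite -subr_ge0 sepquarticB; apply: addr_ge0; last first.
    by rewrite mulr_ge0 ?invr_ge0 ?ler0n ?sqr_ge0.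
  apply: sumr_ge0 => i _; have [-> nu_ge0] := crit i.
  by rewrite subrr mulr0 addr0 mulr_ge0 // sqr_ge0.
set k := a i + _.
suff [/eqP + k0] : k * x i 0 - p i = 0 /\ 0 <= k by rewrite subr_eq0 => /eqP.
apply: (@quartic_ge0 _ _ _ (x i 0)) => t.
pose z := x + t *: delta_mx i 0.
have zi : z i 0 - x i 0 = t by rewrite !mxE !eqxx mulr1 addrC addKr.
have zj j : j != i -> z j 0 = x j 0.
  by move=> /negPf ji; rewrite !mxE ji mulr0 addr0.
have := xmin z; rewrite -subr_ge0 sepquarticB (bigD1 i) //= big1 => [|j ji].
  have -> : sqnorm z - sqnorm x = 2 * x i 0 * t + t ^+ 2.
    rewrite /sqnorm -sumrB (bigD1 i) //= big1 => [|j /zj ->]; last exact: subrr.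
    by move: zi => /eqP; rewrite subr_eq => /eqP ->; ring.
  by rewrite zi -/k addr0.
by rewrite zj // subrr expr0n /= !mulr0 mul0r addr0.
Qed.

(** Row vectors are the form in which [rV_compact] and [EVT_min_rV] apply. *)
Lemma sepquartic_continuous :
  continuous (fun v : 'rV[R]_n => sepquartic v^T).
Proof.
have coord i : continuous (fun v : 'rV[R]_n => v^T i 0).
  by under eq_fun do rewrite mxE; exact: coord_continuous.
have add_cont (f g : 'rV[R]_n -> R) :
    continuous f -> continuous g -> continuous (fun v => f v + g v).
  by move=> fc gc v; exact: (continuousD (fc v) (gc v)).
have mul_cont (f g : 'rV[R]_n -> R) :
    continuous f -> continuous g -> continuous (fun v => f v * g v).
  by move=> fc gc v; exact: (continuousM (fc v) (gc v)).
have cst_cont (k : R) : continuous (fun _ : 'rV[R]_n => k).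
  exact: cst_continuous.
have opp_cont (f : 'rV[R]_n -> R) :
    continuous f -> continuous (fun v => - f v).
  by move=> fc v; exact: (continuousN (fc v)).
have sum_cont (F : 'I_n -> 'rV[R]_n -> R) :
    (forall i, continuous (F i)) -> continuous (fun v => \sum_i F i v).
  move=> Fc; rewrite /index_enum; elim: (Finite.enum _) => [|i s IHs].
    by under eq_fun do rewrite big_nil; exact: cst_cont.
  by under eq_fun do rewrite big_cons; exact: add_cont (Fc i) IHs.
have sqr_cont (f : 'rV[R]_n -> R) :
    continuous f -> continuous (fun v => f v ^+ 2).
  by move=> fc; exact: mul_cont.
rewrite /sepquartic /sqnorm.
refine (add_cont _ _ _ _).
  refine (sum_cont _ _) => i; refine (add_cont _ _ _ _).
    exact/mul_cont/sqr_cont/coord.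
  exact/opp_cont/mul_cont/coord.
refine (mul_cont _ _ _ _) => //; refine (sqr_cont _ _).
refine (add_cont _ _ _ _) => //; refine (sum_cont _ _) => i.
exact/sqr_cont/coord.
Qed.

Lemma sepquartic_has_min : (forall i, 0 < a i) ->
  exists x, forall z, sepquartic x <= sepquartic z.
Proof.
move=> a_gt0.
(* Completing squares bounds the separable part below by [- e]. *)
pose e := \sum_i p i ^+ 2 / a i.
have lower x : 2^-1 * (sqnorm x - c) ^+ 2 - e <= sepquartic x.
  rewrite addrC lerD2r /e -sumrN; apply: ler_sum => i _.
  rewrite -subr_ge0 (_ : _ - _ = a i * (x i 0 - p i / a i) ^+ 2).
    by rewrite mulr_ge0 ?sqr_ge0 // ltW.
  by field; rewrite gt_eqF.
(* As [M >= 1], a coordinate beyond [M] forces [sqnorm x > M], so [u = sqnorm x - c] exceeds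
   [1 + c ^+ 2 + 2 * e]. Then [u ^+ 2 > u], and the lower bound beats the value [c ^+ 2 / 2] at the
   origin. *)
pose M := 1 + `|c| + c ^+ 2 + 2 * e.
have e_ge0 : 0 <= e.
  by apply: sumr_ge0 => i _; rewrite mulr_ge0 ?sqr_ge0 ?invr_ge0 ?ltW.
have M1 : 1 <= M.
  by rewrite /M; have := normr_ge0 c; have := sqr_ge0 c; lra.
have far x i : M < `|x i 0| -> sepquartic 0 < sepquartic x.
  move=> Mx; apply: lt_le_trans (lower x).
  have sq0 : sqnorm (0 : 'cV[R]_n) = 0.
    by rewrite /sqnorm big1 // => j _; rewrite mxE expr0n.
  have -> : sepquartic 0 = 2^-1 * c ^+ 2.
    rewrite /sepquartic sq0 sub0r sqrrN big1 ?add0r // => j _.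
    by rewrite !mxE expr0n /= !mulr0 subr0.
  have : M < sqnorm x.
    rewrite /sqnorm (bigD1 i) //=; apply: (@lt_le_trans _ _ (x i 0 ^+ 2)).
      rewrite -real_normK ?num_real //.
      by apply: lt_trans (Mx) _; rewrite expr2 ltr_pMl //; lra.
    by rewrite lerDl; apply: sumr_ge0 => j _; exact: sqr_ge0.
  rewrite /M => Ms.
  have : 1 + c ^+ 2 + 2 * e < sqnorm x - c by have := ler_norm c; lra.
  have := sqr_ge0 c; nra.
pose K := [set v : 'rV[R]_n | forall i, `[- M, M]%classic (v ord0 i)]%classic.
have K0 : K 0.
  by move=> i; rewrite /= mxE in_itv /=; apply/andP; split; lra.
have Kcompact : compact K.
  apply: (rV_compact (A := fun=> `[- M, M]%classic)) => i.
  exact: segment_compact.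
have [|v _ vmin] := EVT_min_rV _ Kcompact
  (continuous_subspaceT sepquartic_continuous); first by exists 0.
exists v^T => z.
(* Outside the box, compare through the origin, which lies in [K]. *)
have [i Mz|zM] := pickP (fun i => M < `|z i 0|).
  apply: le_trans (ltW (far _ _ Mz)).
  by rewrite -(trmx0 R 1 n); apply: vmin; rewrite inE.
rewrite -[z]trmxK; apply: vmin; rewrite inE => i /=.
by rewrite mxE in_itv /= -ler_norml leNgt; have := zM i => /= ->.
Qed.

End SeparableQuartic.

(** * Elimination of [y] and reduction to the separable quartic *)

Section Reformulation.
Variable R : realType.

Lemma enorm_sqr n (u : 'cV[R]_n) : enorm u ^+ 2 = sqnorm u.
Proof. by rewrite sqr_sqrtr // sumr_ge0 // => i _; exact: sqr_ge0. Qed.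

Lemma sqnormE n (u : 'cV[R]_n) : sqnorm u = (u^T *m u) 0 0.
Proof. by rewrite mxE; apply: eq_bigr => i _; rewrite mxE. Qed.

Lemma sqnormZ n k (u : 'cV[R]_n) : sqnorm (k *: u) = k ^+ 2 * sqnorm u.
Proof.
by rewrite /sqnorm mulr_sumr; apply: eq_bigr => i _; rewrite mxE exprMn.
Qed.

Lemma sqnorm_col_mx n1 n2 (u : 'cV[R]_n1) (v : 'cV[R]_n2) :
  sqnorm (col_mx u v) = sqnorm u + sqnorm v.
Proof.
rewrite /sqnorm big_split_ord /=; congr (_ + _); apply: eq_bigr => i _.
  by rewrite col_mxEu.
by rewrite col_mxEd.
Qed.

Lemma sqnorm_const_mx1 (k : R) : sqnorm (const_mx k : 'cV[R]_1) = k ^+ 2.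
Proof. by rewrite /sqnorm big_ord1 mxE. Qed.

Lemma zvecP n (z : 'cV[R]_(n + 1)) : exists x y, z = zvec x y.
Proof.
exists (usubmx z), (dsubmx z 0 0); rewrite -[LHS]vsubmxK; congr col_mx.
by apply/matrixP => i j; rewrite !ord1 [RHS]mxE.
Qed.

Lemma c_constr_zvec n (x : 'cV[R]_n) y :
  c_constr (zvec x y) = 2^-1 * (sqnorm x - y).
Proof.
rewrite /c_constr /dot /Q0 /q0 /zvec mul_block_col !tr_col_mx !mul_row_col.
rewrite !mul0mx !mul1mx !addr0 mulmx0 addr0 trmx0 mul0mx add0r -sqnormE.
by rewrite [X in _ - X]mxE big_ord1 !mxE /=; field.
Qed.

Lemma q_obj_zvec m n w (A : 'M[R]_(n, m)) b b0 (x : 'cV[R]_n) y : 0 <= w ->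
  q_obj w A b b0 (zvec x y) =
  w * sqnorm (A^T *m x - b) + 2^-1 * (y - b0) ^+ 2.
Proof.
move=> w_ge0; rewrite /q_obj enorm_sqr /Abar /bbar /zvec.
rewrite tr_block_mx !trmx0 trmx1.
rewrite mul_block_col !mul0mx mul1mx addr0 add0r opp_col_mx add_col_mx.
rewrite linearZ /= -scalemxAl -scalerBr sqnorm_col_mx sqnormZ.
rewrite sqr_sqrtr ?mulr_ge0 //.
have -> : const_mx y - const_mx b0 = const_mx (y - b0) :> 'cV[R]_1.
  by apply/matrixP => i j; rewrite !mxE.
by rewrite sqnorm_const_mx1; field.
Qed.

(** The quadratic form of the residual is [A *m A^T]; its being diagonal decouples the
    coordinates. *)
Lemma sqnorm_residual m n (A : 'M[R]_(n, m)) (lam : 'rV[R]_n) b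
    (x : 'cV[R]_n) :
  A *m A^T = diag_mx lam ->
  sqnorm (A^T *m x - b) =
  \sum_i (lam 0 i * x i 0 ^+ 2 - 2 * (A *m b) i 0 * x i 0) + sqnorm b.
Proof.
move=> AAT; rewrite sqnormE.
have -> : (A^T *m x - b)^T = x^T *m A - b^T.
  by rewrite linearB /= trmx_mul trmxK.
rewrite mulmxBl !mulmxBr.
have -> : b^T *m (A^T *m x) = (x^T *m A *m b)^T.
  by rewrite !trmx_mul trmxK mulmxA.
have -> : x^T *m A *m (A^T *m x) = x^T *m diag_mx lam *m x.
  by rewrite -AAT !mulmxA.
have entryB (M N : 'M[R]_1) : (M - N) 0 0 = M 0 0 - N 0 0 by rewrite !mxE.
rewrite -(mulmxA x^T A b) sumrB !entryB -sqnormE [_^T 0 0]mxE.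
have -> : (x^T *m diag_mx lam *m x) 0 0 = \sum_i lam 0 i * x i 0 ^+ 2.
  by rewrite mxE; apply: eq_bigr => i _; rewrite mul_mx_diag !mxE; ring.
have -> : \sum_i 2 * (A *m b) i 0 * x i 0 = 2 * (x^T *m (A *m b)) 0 0.
  rewrite [in RHS]mxE mulr_sumr.
  by apply: eq_bigr => i _; rewrite [x^T _ _]mxE; ring.
by ring.
Qed.

Lemma coord_mx_mul_tr m n (U : 'M[R]_(m, n)) (lam : 'rV[R]_n) :
  (forall i, 0 < lam 0 i) -> U^T *m U = 1%:M ->
  coord_mx U lam *m (coord_mx U lam)^T = diag_mx lam.
Proof.
move=> lam_gt0 UU; rewrite /coord_mx trmx_mul trmxK tr_diag_mx.
rewrite mulmxA -(mulmxA _ _ U) UU mulmx1 mulmx_diag.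
congr diag_mx; apply/rowP => i.
by rewrite !mxE -expr2 sqr_sqrtr // ltW.
Qed.

(** On feasible points the objective is [f] plus the constant [w * sqnorm b]. *)
Lemma global_solution_zvec m n w (A : 'M[R]_(n, m)) (lam : 'rV[R]_n) b b0
    (x : 'cV[R]_n) y :
  0 <= w -> A *m A^T = diag_mx lam ->
  let f := sepquartic (fun i => w * lam 0 i) (fun i => w * (A *m b) i 0) b0 in
  global_solution (q_obj w A b b0) (@c_constr R n) (zvec x y) <->
  y = sqnorm x /\ forall z, f x <= f z.
Proof.
move=> w_ge0 AAT f.
have feasible (z : 'cV[R]_n) t : (c_constr (zvec z t) = 0) <-> (t = sqnorm z).
  by rewrite c_constr_zvec; split => [|->]; lra.
have qE z : q_obj w A b b0 (zvec z (sqnorm z)) = f z + w * sqnorm b.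
  rewrite q_obj_zvec // (sqnorm_residual _ _ AAT) mulrDr mulr_sumr.
  rewrite /f /sepquartic addrAC; congr (_ + _ + _); apply: eq_bigr => i _; ring.
split=> [[/feasible -> xmin]|[-> xmin]].
  split=> // z; rewrite -(lerD2r (w * sqnorm b)) -!qE.
  by apply: xmin; exact/feasible.
split=> [|z']; first exact/feasible.
by have [z [t ->]] := zvecP z' => /feasible ->; rewrite !qE lerD2r.
Qed.

End Reformulation.

(* The embedding dimension is r.+1, so that it is positive and the smallest
   eigenvalue lam 0 ord_max makes sense. *)
Theorem theorem4 (R : realType) (m r : nat)
    (anchor : 'I_m -> 'cV[R]_r.+1) (delta : 'cV[R]_m)
    (U : 'M[R]_(m, r.+1)) (lam : 'rV[R]_r.+1) (w : R) :
  let D := sqdist_mx anchor in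
  let B := gram_mx D in
  let A := coord_mx U lam in
  let b := rhs_vec D delta in
  let b0 := rhs_scal D delta in
  let solution := global_solution (q_obj w A b b0) (@c_constr R r.+1) in
  \rank B = r.+1 ->
  reduced_spectral_decomposition B U lam ->
  0 < w ->
  (exists z : 'cV[R]_(r.+1 + 1), solution z) /\
  (forall (x : 'cV[R]_r.+1) (y : R),
    solution (zvec x y) <->
    exists mu : R,
      [/\ (diag_mx lam + ((2 * w)^-1 * mu)%:M) *m x = A *m b,
          y = b0 + 2^-1 * mu,
          - (2 * w) * lam 0 ord_max <= mu
        & y = enorm x ^+ 2]).
Proof.
move=> D B A b b0 solution _ [lam_noninc lam_gt0 UU _] w_gt0.
have AAT := coord_mx_mul_tr lam_gt0 UU.
have solP x y := global_solution_zvec b b0 x y (ltW w_gt0) AAT.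
split.
  have [|x xmin] := @sepquartic_has_min _ _ (fun i => w * lam 0 i)
    (fun i => w * (A *m b) i 0) b0.
    by move=> i; rewrite mulr_gt0.
  by exists (zvec x (sqnorm x)); apply/solP.
have stationaryE x nu : (diag_mx lam + nu%:M) *m x = A *m b <->
    forall i, (lam 0 i + nu) * x i 0 = (A *m b) i 0.
  rewrite mulmxDl mul_scalar_mx mul_diag_mx; split=> [/matrixP E i|E].
    by rewrite -E !mxE; ring.
  by apply/matrixP => i j; rewrite ord1 -E !mxE; ring.
move=> x y; rewrite enorm_sqr; split.
  (* The multiplier is forced by [y = b0 + mu / 2] and [y = sqnorm x]. The criterion at [i] is then
     [w] times the stationarity equation, and its sign at [ord_max] is the bound on [mu]. *)
  move=> /solP[-> /sepquartic_minP crit]; exists (2 * (sqnorm x - b0)).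
  split=> //.
  - apply/stationaryE => i; have [E _] := crit i.
    by apply: (mulfI (lt0r_neq0 w_gt0)); rewrite -E; field; rewrite gt_eqF.
  - by field.
  - by have [_] := crit ord_max; lra.
move=> [mu [/stationaryE E ymu mu_ge yx]]; apply/solP; split=> //.
apply/sepquartic_minP => i; rewrite -yx.
have -> : y - b0 = 2^-1 * mu by rewrite ymu addrC addKr.
split; first by rewrite -E; field; rewrite gt_eqF.
(* The last eigenvalue is the smallest, so the bound on [mu] yields the sign condition for every
   [i]. *)
have : w * lam 0 ord_max <= w * lam 0 i.
  by rewrite ler_pM2l //; apply: lam_noninc; rewrite -ltnS.
by lra.
Qed.
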